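(* Let $B$ be a monoid, let $A$ be a left $B$-monoid via a homomorphism of monoids $\phi : B \to \mathrm{End}(A)$, and let $A\phi B$ be the corresponding semi-direct product. The assignment $$\chi \longmapsto \{\chi(b)b : b \in B\} \subseteq A\phi B$$ establishes an isomorphism of pointed sets $$\mathcal{Z}^1(B, U(A)) \simeq \mathsf{FAC}(A/A\phi B).$$
   Context: $\mathrm{End}(A)$ is the monoid of monoid endomorphisms of $A$ under composition. A homomorphism $\phi : B \to \mathrm{End}(A)$ is the same as a left action of the monoid $B$ on the monoid $A$, written $b \star a = \phi(b)(a)$; it restricts to a left action of $B$ on the group $U(A)$ of invertible elements of $A$. The semi-direct product $A\phi B$ is the set of formal products $ab$ with $a \in A$, $b \in B$ (i.e. $A\times B$ as a set), with identity $1_A 1_B$ and multiplication $(a_1 b_1)\bullet(a_2 b_2) = \big(a_1 (b_1 \star a_2)\big)(b_1 b_2)$. $A$ and $B$ are identified with the submonoids $\{a 1_B : a\in A\}$ and $\{1_A b : b \in B\}$ of $A\phi B$; then $(A,B)$ is a factorization of $A\phi B$. For a monoid $C$ with a left $B$-action, $\mathcal{Z}^1(B,C)$ is the set of 1-cocycles: maps $\chi : B \to C$ with $\chi(1_B) = 1_C$ and $\chi(b_1 b_2) = \chi(b_1)\,(b_1 \star \chi(b_2))$ for all $b_1,b_2 \in B$, pointed by the constant map with value $1_C$. A pair $(A,C)$ of submonoids of a monoid $M$ is a factorization of $M$ if the multiplication map $A \times C \to M$, $(a,c)\mapsto ac$, is bijective; $\mathsf{FAC}(A/M)$ is the set of submonoids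 $C$ of $M$ such that $(A,C)$ is a factorization of $M$. $\mathsf{FAC}(A/A\phi B)$ is pointed by $B$. *)

(* Defs.v *)
From HB Require Import structures.
From mathcomp Require Import all_boot.
From mathcomp Require Import boolp classical_sets functions.

Set Implicit Arguments.
Unset Strict Implicit.
Unset Printing Implicit Defensive.

Local Open Scope classical_set_scope.
Local Open Scope group_scope.

(* The library bundles monoid homomorphisms but has no notation for them. *)
Notation "{ 'mhom' A -> B }" := (UMagmaMorphism.type A%type B%type)
  (at level 0, A at level 98, B at level 99, format "{ 'mhom'  A  ->  B }")
  : type_scope.

Section Endomorphisms.
Variable A : monoidType.

Lemma mhomP (f g : {mhom A -> A}) : f =1 g -> f = g.
Proof.
case: f => f [[fM] [f1]]; case: g => g [[gM] [g1]] /= /funext fg.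
by subst g; rewrite (Prop_irrelevance fM gM) (Prop_irrelevance f1 g1).
Qed.

Definition End : Type := {mhom A -> A}.

(* [monoidType] extends [choiceType], whence the classical instances. *)
HB.instance Definition _ := gen_eqMixin End.
HB.instance Definition _ := gen_choiceMixin End.

Definition End_one : End := (idfun : A -> A).
Definition End_mul (f g : End) : End :=
  ((f : {mhom A -> A}) \o (g : {mhom A -> A})).

Fact End_mulA : associative End_mul.
Proof. by move=> f g h; apply: mhomP. Qed.
Fact End_mul1 : left_id End_one End_mul.
Proof. by move=> f; apply: mhomP. Qed.
Fact End_mulr1 : right_id End_one End_mul.
Proof. by move=> f; apply: mhomP. Qed.
HB.instance Definition _ := isMonoid.Build End End_mulA End_mul1 End_mulr1.

End Endomorphisms.

Section Units.
Variable A : monoidType.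

Definition munit : {pred A} :=
  [pred a | `[< exists a', a * a' = 1 /\ a' * a = 1 >]].

Fact munit_closed : monoid_closed munit.
Proof.
split; first by apply/asboolP; exists 1; rewrite mulg1.
move=> a b /asboolP[a' [aa' a'a]] /asboolP[b' [bb' b'b]].
apply/asboolP; exists (b' * a'); split.
  by rewrite mulgA -(mulgA a) bb' mulg1.
by rewrite mulgA -(mulgA b') a'a mulg1.
Qed.

Record U := MUnit { munit_val : A; _ : munit_val \in munit }.

HB.instance Definition _ := [isSub for munit_val].
HB.instance Definition _ := [Choice of U by <:].
HB.instance Definition _ := SubChoice_isSubMonoid.Build A munit U munit_closed.

Fact U_has_inv (u : U) : exists v : U, v * u = 1 /\ u * v = 1.
Proof.
have /asboolP[a [ua au]] := valP u.
have aP : a \in munit by apply/asboolP; exists (val u).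
by exists (MUnit aP); split; apply: val_inj; rewrite gmulfM gmulf1.
Qed.

Definition U_inv (u : U) : U := projT1 (cid (U_has_inv u)).

HB.instance Definition _ := hasInv.Build U U_inv.

Fact U_mulVg : left_inverse 1 U_inv *%g.
Proof. by move=> u; rewrite /U_inv; case: cid => v []. Qed.
Fact U_mulgV : right_inverse 1 U_inv *%g.
Proof. by move=> u; rewrite /U_inv; case: cid => v []. Qed.
HB.instance Definition _ := Monoid_isGroup.Build U U_mulVg U_mulgV.

End Units.

Section RestrictedAction.
Variables A B : monoidType.

Fact End_munit (f : End A) (u : U A) : f (val u) \in @munit A.
Proof.
have /asboolP[a [ua au]] := valP u.
by apply/asboolP; exists (f a); rewrite -!gmulfM ua au gmulf1.
Qed.

Definition End_U_fun (f : End A) (u : U A) : U A := MUnit (End_munit f u).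

Fact End_U_morphism (f : End A) : monoid_morphism (End_U_fun f).
Proof.
split=> [|u v]; apply: val_inj => /=; first by rewrite gmulf1.
by rewrite gmulfM.
Qed.
HB.instance Definition _ (f : End A) :=
  isUMagmaMorphism.Build (U A) (U A) (End_U_fun f) (End_U_morphism f).

Definition End_U (f : End A) : End (U A) := End_U_fun f.

Variable phi : {mhom B -> End A}.

Definition act_U_fun (b : B) : End (U A) := End_U (phi b).

Fact act_U_morphism : monoid_morphism act_U_fun.
Proof.
split=> [|b c]; apply: mhomP => u; apply: val_inj => /=.
  by rewrite gmulf1.
by rewrite gmulfM.
Qed.
HB.instance Definition _ :=
  isUMagmaMorphism.Build B (End (U A)) act_U_fun act_U_morphism.

Definition act_U : {mhom B -> End (U A)} := act_U_fun.

End RestrictedAction.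

(* A fresh record rather than an alias of [A * B], which already carries the
   monoid structure of the direct product. *)
Record sdprod (A B : monoidType) (phi : {mhom B -> End A}) :=
  SDPair { sdfst : A; sdsnd : B }.
Arguments SDPair {A B} phi.

Section SemidirectProduct.
Variables (A B : monoidType) (phi : {mhom B -> End A}).

HB.instance Definition _ := gen_eqMixin (sdprod phi).
HB.instance Definition _ := gen_choiceMixin (sdprod phi).

Definition sdone : sdprod phi := SDPair phi 1 1.
Definition sdmul (x y : sdprod phi) : sdprod phi :=
  SDPair phi (sdfst x * phi (sdsnd x) (sdfst y)) (sdsnd x * sdsnd y).

Fact sdmulA : associative sdmul.
Proof. by move=> x y z; rewrite /sdmul /= !gmulfM !mulgA. Qed.
Fact sdmul1 : left_id sdone sdmul.
Proof. by case=> a b; rewrite /sdmul /= gmulf1 !mul1g. Qed.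
Fact sdmulr1 : right_id sdone sdmul.
Proof. by case=> a b; rewrite /sdmul /= gmulf1 !mulg1. Qed.
HB.instance Definition _ :=
  isMonoid.Build (sdprod phi) sdmulA sdmul1 sdmulr1.

Definition sdinl (a : A) : sdprod phi := SDPair phi a 1.
Definition sdinr (b : B) : sdprod phi := SDPair phi 1 b.

End SemidirectProduct.

Definition Z1 (B C : monoidType) (psi : {mhom B -> End C}) : set (B -> C) :=
  [set chi | chi 1 = 1 /\
     forall b1 b2, chi (b1 * b2) = chi b1 * psi b1 (chi b2)].

Definition factorization (M : monoidType) (A C : set M) : Prop :=
  [/\ monoid_closed [in A], monoid_closed [in C] &
      set_bij (A `*` C) [set: M] (fun p => p.1 * p.2)].

Definition FAC (M : monoidType) (A : set M) : set (set M) :=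
  [set C | factorization A C].

Definition pointed_iso (S T : Type) (X : set S) (x0 : S) (Y : set T) (y0 : T)
    (f : S -> T) : Prop :=
  [/\ X x0, Y y0, set_bij X Y f & f x0 = y0].

Definition cocycle_graph (A B : monoidType) (phi : {mhom B -> End A})
    (chi : B -> U A) : set (sdprod phi) :=
  [set sdinl phi (val (chi b)) * sdinr phi b | b in [set: B]].
Arguments cocycle_graph {A B} phi chi.

(* Main.v *)
Require Import Defs.
From mathcomp Require Import all_boot.
From mathcomp Require Import boolp classical_sets functions.

Local Open Scope classical_set_scope.
Local Open Scope group_scope.

(** An element (x, b) of a complement C of A factors both as 1 (x, b) and, writing
    1_A b = a c with c in C, as (x a) c.  Uniqueness gives c = (x, b) and x a = 1,
    while comparing first components of 1_A b = a c gives a x = 1.  So C is the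
    graph of a function from B to U(A), and C being a submonoid is exactly the
    cocycle condition for this function. *)

(** Units cancel on the right against arbitrary elements of A; this yields uniqueness of
    factorizations below, and [unit_mulVK] their existence. *)
Lemma unit_mulK (A : monoidType) (u : U A) :
  cancel (fun a : A => a * val u) (fun a => a * val u^-1).
Proof. by move=> a; rewrite -mulgA -gmulfM mulgV gmulf1 mulg1. Qed.

Lemma unit_mulVK (A : monoidType) (u : U A) :
  cancel (fun a : A => a * val u^-1) (fun a => a * val u).
Proof. by move=> a; rewrite -mulgA -gmulfM mulVg gmulf1 mulg1. Qed.

Lemma sdmulE (A B : monoidType) (phi : {mhom B -> End A}) (x y : sdprod phi) :
  x * y = SDPair phi (sdfst x * phi (sdsnd x) (sdfst y)) (sdsnd x * sdsnd y).
Proof. by []. Qed.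

Lemma sdinl_mul (A B : monoidType) (phi : {mhom B -> End A}) (a : A)
    (x : sdprod phi) :
  sdinl phi a * x = SDPair phi (a * sdfst x) (sdsnd x).
Proof. by rewrite sdmulE /= gmulf1 mul1g. Qed.

Lemma cocycle_graphP (A B : monoidType) (phi : {mhom B -> End A})
    (chi : B -> U A) (x : sdprod phi) :
  cocycle_graph phi chi x <-> sdfst x = val (chi (sdsnd x)).
Proof.
split=> [[b _ <-]|]; first by rewrite sdinl_mul /= mulg1.
by case: x => a b /= ->; exists b => //; rewrite sdinl_mul /= mulg1.
Qed.

Lemma sdinl_closed (A B : monoidType) (phi : {mhom B -> End A}) :
  monoid_closed [in range (sdinl phi)].
Proof.
split=> [|_ _ /set_mem[a _ <-] /set_mem[b _ <-]]; apply/mem_set; first by exists 1.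
by exists (a * b) => //; rewrite sdinl_mul.
Qed.

(** As (a, b) = (a chi(b)^-1) (chi(b) b), invertibility of chi(b) makes every element factor, and in
    one way only; the cocycle identity is closure under products. *)
Lemma cocycle_graph_FAC (A B : monoidType) (phi : {mhom B -> End A})
    (chi : B -> U A) :
  Z1 (act_U phi) chi -> FAC (range (sdinl phi)) (cocycle_graph phi chi).
Proof.
case=> chi1 chiM; split; first exact: sdinl_closed.
  split=> [|x y /set_mem/cocycle_graphP xP /set_mem/cocycle_graphP yP].
    by apply/mem_set/cocycle_graphP; rewrite /= chi1.
  by apply/mem_set/cocycle_graphP; rewrite sdmulE /= chiM xP yP.
split; first by [].
- case=> [p [x b]] [q [y c]] /set_mem[/= [a _ <-] /cocycle_graphP/= ->].
  move=> /set_mem[/= [a' _ <-] /cocycle_graphP/= ->].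
  (* The second components agree, so both sides involve the same unit, which cancels from the first
     components. *)
  by rewrite !sdinl_mul => -[/[swap] <- /(can_inj (unit_mulK _ _))->].
- case=> a b _.
  exists (sdinl phi (a * val (chi b)^-1), SDPair phi (val (chi b)) b).
    by split; [exists (a * val (chi b)^-1)|apply/cocycle_graphP].
  by rewrite sdinl_mul /= unit_mulVK.
Qed.

(** The value chi(b) is recovered as the first component of the only point of the graph over b,
    whether or not chi is a cocycle. *)
Lemma cocycle_graph_inj (A B : monoidType) (phi : {mhom B -> End A}) :
  injective (cocycle_graph phi).
Proof.
move=> chi chi' eqG; apply/funext => b; apply: val_inj.
have : cocycle_graph phi chi (SDPair phi (val (chi b)) b).
  exact/cocycle_graphP.
by rewrite eqG => /cocycle_graphP.
Qed.

Lemma FAC_sdinl_section (A B : monoidType) (phi : {mhom B -> End A})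
    (C : set (sdprod phi)) (b : B) :
  FAC (range (sdinl phi)) C ->
  exists u : U A, forall x, C (SDPair phi x b) <-> x = val u.
Proof.
case=> _ _ [_ injC /(_ (sdinr phi b) I) surjC].
(* Factor 1_A b as a (x b'): comparing components gives a x = 1 and b' = b. *)
case: surjC => -[_ [x b']] [/= [a _ <-] Cxb].
rewrite sdinl_mul /= => -[ax1 eb]; subst b'.
have uniqC y : C (SDPair phi y b) -> y * a = 1 /\ y = x.
  move=> Cyb.
  have range_C z d : C d -> (sdinl phi z, d) \in range (sdinl phi) `*` C.
    by move=> Cd; apply/mem_set; split=> //; exists z.
  (* Since a x = 1, the element y b of C factors both as 1 (y b) and as (y a) (x b). *)
  have eq_prod : sdinl phi 1 * SDPair phi y b = sdinl phi (y * a) * SDPair phi x b.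
    by rewrite !sdinl_mul /= -mulgA ax1 mul1g mulg1.
  by have [<- ->] := injC _ _ (range_C 1 _ Cyb) (range_C (y * a) _ Cxb) eq_prod.
(* The case y = x gives x a = 1, so a is a two-sided inverse of x. *)
have xU : x \in @munit A by apply/asboolP; exists a; rewrite (uniqC x Cxb).1.
by exists (MUnit xU) => y; split=> [/uniqC[]//|->].
Qed.

Lemma FAC_cocycle_graph (A B : monoidType) (phi : {mhom B -> End A})
    (C : set (sdprod phi)) :
  FAC (range (sdinl phi)) C ->
  exists2 chi, Z1 (act_U phi) chi & cocycle_graph phi chi = C.
Proof.
move=> facC.
have [chi chiP] := choice (fun b => @FAC_sdinl_section _ _ _ _ b facC).
have Cchi b : C (SDPair phi (val (chi b)) b) by apply/chiP.
exists chi; last first.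
  apply/seteqP; split=> -[x b].
    by move=> /cocycle_graphP/= /chiP.
  by move=> /chiP xE; apply/cocycle_graphP.
have [_ [/set_mem C1 CM] _] := facC.
(* C has a single point over each element of B. Over 1 it is the identity, and over b c it is the
   product of the points over b and c. *)
split=> [|b c]; apply: val_inj; first by rewrite gmulf1; apply/esym/chiP.
rewrite gmulfM; apply/esym/chiP.
by have /set_mem := CM _ _ (mem_set (Cchi b)) (mem_set (Cchi c)).
Qed.

Theorem theorem3p8 (A B : monoidType) (phi : {mhom B -> End A}) :
  pointed_iso (Z1 (act_U phi)) (fun _ : B => 1)
              (FAC (range (sdinl phi))) (range (sdinr phi))
              (cocycle_graph phi).
Proof.
have Z1_1 : Z1 (act_U phi) (fun _ : B => 1).
  by split=> // b c; rewrite gmulf1 mulg1.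
have graph1 : cocycle_graph phi (fun _ => 1) = range (sdinr phi).
  apply/seteqP; split=> [[x b] /cocycle_graphP/= ->|_ [b _ <-]].
    by exists b.
  exact/cocycle_graphP.
(* That B is a complement of A is the case of the trivial cocycle. *)
split=> //; first by rewrite -graph1; exact: cocycle_graph_FAC.
split.
- exact: cocycle_graph_FAC.
- by move=> chi chi' _ _ /cocycle_graph_inj.
- by move=> C /FAC_cocycle_graph.
Qed.
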